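(* If a category $\mathcal{C}$ has countable products, then the forgetful functor $\lfloor\,\rfloor:\boldsymbol{\sigma}\text{-}\mathcal{C}\to\mathcal{C}$ admits a right adjoint $|\,\cdot\,\rceil$, i.e. $\lfloor\,\rfloor\dashv|\,\cdot\,\rceil$.
   Context: $\boldsymbol{\sigma}\text{-}\mathcal{C}$ is the category whose objects are pairs $(X,\sigma_X)$ with $X$ an object of $\mathcal{C}$ and $\sigma_X\in\mathcal{C}(X,X)$, and whose morphisms $(X,\sigma_X)\to(Y,\sigma_Y)$ are the $f\in\mathcal{C}(X,Y)$ with $f\circ\sigma_X=\sigma_Y\circ f$. The forgetful functor is $\lfloor(X,\sigma_X)\rfloor=X$. *)

(* Defs.v *)
From Stdlib Require Import ProofIrrelevance.
From mathcomp Require Import all_boot.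

Set Implicit Arguments.
Unset Strict Implicit.
Unset Printing Implicit Defensive.

Declare Scope cat_scope.
Delimit Scope cat_scope with cat.
Local Open Scope cat_scope.

Reserved Notation "g ∘ f" (at level 40, left associativity).
Reserved Notation "F ⊣ G" (at level 70, no associativity).

Record category := Category {
  ob :> Type;
  hom : ob -> ob -> Type;
  idm : forall X : ob, hom X X;
  comp : forall X Y Z : ob, hom Y Z -> hom X Y -> hom X Z;
  comp_idl : forall (X Y : ob) (f : hom X Y), comp (idm Y) f = f;
  comp_idr : forall (X Y : ob) (f : hom X Y), comp f (idm X) = f;
  comp_assoc : forall (W X Y Z : ob) (h : hom Y Z) (g : hom X Y) (f : hom W X),
    comp h (comp g f) = comp (comp h g) f
}.

Arguments hom {c} X Y.
Arguments idm {c} X.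
Arguments comp {c X Y Z} g f.

Notation "g ∘ f" := (comp g f) : cat_scope.

Record functor (C D : category) := Functor {
  fobj :> C -> D;
  fmap : forall X Y : C, hom X Y -> hom (fobj X) (fobj Y);
  fmap_id : forall X : C, fmap (idm X) = idm (fobj X);
  fmap_comp : forall (X Y Z : C) (g : hom Y Z) (f : hom X Y),
    fmap (g ∘ f) = fmap g ∘ fmap f
}.

Arguments fmap {C D} F {X Y} f : rename.

(* F is left adjoint to G: there is a bijection D(F X, Y) -> C(X, G Y),
   natural in X and in Y. *)
Definition adjoint (C D : category) (F : functor C D) (G : functor D C) : Prop :=
  exists phi : forall (X : C) (Y : D), hom (F X) Y -> hom X (G Y),
    [/\ forall (X : C) (Y : D), bijective (@phi X Y),
        forall (X X' : C) (Y : D) (f : hom (F X) Y) (u : hom X' X),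
          phi X' Y (f ∘ fmap F u) = phi X Y f ∘ u
      & forall (X : C) (Y Y' : D) (v : hom Y Y') (f : hom (F X) Y),
          phi X Y' (v ∘ f) = fmap G v ∘ phi X Y f].

Notation "F ⊣ G" := (adjoint F G) : cat_scope.

Definition is_product (C : category) (I : Type) (X : I -> C) (P : C)
    (p : forall i : I, hom P (X i)) : Prop :=
  forall (Z : C) (f : forall i : I, hom Z (X i)),
    exists! h : hom Z P, forall i : I, p i ∘ h = f i.

(* Countable index sets may be finite, including empty. *)
Definition has_countable_products (C : category) : Prop :=
  forall (I : countType) (X : I -> C),
    exists (P : C) (p : forall i : I, hom P (X i)), is_product p.

Section Sigma.
Variable C : category.

Record sigma_ob := SigmaOb {
  carrier : C;
  sigma : hom carrier carrier
}.

Definition sigma_hom (X Y : sigma_ob) : Type :=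
  {f : hom (carrier X) (carrier Y) | f ∘ sigma X = sigma Y ∘ f}.

Definition sigma_id (X : sigma_ob) : sigma_hom X X.
Proof. by exists (idm (carrier X)); rewrite comp_idl comp_idr. Defined.

Definition sigma_comp (X Y Z : sigma_ob) (g : sigma_hom Y Z)
  (f : sigma_hom X Y) : sigma_hom X Z.
Proof.
exists (sval g ∘ sval f).
by rewrite -comp_assoc (svalP f) comp_assoc (svalP g) comp_assoc.
Defined.

Lemma sigma_hom_inj (X Y : sigma_ob) (f g : sigma_hom X Y) :
  sval f = sval g -> f = g.
Proof. by case: f g => [f fP] [g gP] /= fg; apply: subset_eq_compat. Qed.

Definition sigma_cat : category.
Proof.
refine (@Category sigma_ob sigma_hom sigma_id sigma_comp _ _ _).
- by move=> X Y f; apply: sigma_hom_inj; rewrite /= comp_idl.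
- by move=> X Y f; apply: sigma_hom_inj; rewrite /= comp_idr.
- by move=> W X Y Z h g f; apply: sigma_hom_inj; rewrite /= comp_assoc.
Defined.

Definition forget : functor sigma_cat C :=
  @Functor sigma_cat C carrier (fun X Y f => sval f)
    (fun=> erefl) (fun _ _ _ _ _ => erefl).

End Sigma.

(* Main.v *)
Require Import Defs.
From Stdlib Require Import ClassicalEpsilon.
From mathcomp Require Import all_boot.

Local Open Scope cat_scope.

(** The right adjoint sends [Y] to its [nat]-indexed power [P] with the shift
    endomorphism [s], characterised by [p n ∘ s = p n.+1] on the projections;
    the counit is [p 0].  An equivariant [k : (X, t) -> (P, s)] satisfies
    [p n.+1 ∘ k = p n ∘ s ∘ k = p n ∘ k ∘ t], so its components are the orbit
    [f, f ∘ t, f ∘ t ∘ t, ...] of [f = p 0 ∘ k]; conversely the orbit of any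
    [f : X -> Y] defines an equivariant map into [P].  This is the couniversal
    property of [p 0] ([shift_couniversal]), and a choice of couniversal arrows
    makes up a right adjoint ([right_adjoint_of_couniversal]). *)

(** [eps] is terminal among the arrows from the image of [F] to [Y]. *)
Definition couniversal {C D : category} (F : functor C D) (Y : D) (R : C)
    (eps : hom (F R) Y) : Prop :=
  forall (X : C) (f : hom (F X) Y), exists! h : hom X R, eps ∘ fmap F h = f.

(** The functor sends [v] to the factorisation of [v ∘ eps]; functoriality and
    both naturality conditions hold since factorisations are unique.  Choice is
    needed because the couniversal arrows are only assumed to exist. *)
Lemma right_adjoint_of_couniversal (C D : category) (F : functor C D) :
    (forall Y : D, exists (R : C) (eps : hom (F R) Y), couniversal F Y R eps) ->
  exists G : functor D C, F ⊣ G.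
Proof.
move=> couniv.
pose R Y := sval (constructive_indefinite_description _ (couniv Y)).
have [eps epsP] : {eps : forall Y, hom (F (R Y)) Y |
    forall Y, couniversal F Y (R Y) (eps Y)}.
  pose epsD Y := constructive_indefinite_description _
    (svalP (constructive_indefinite_description _ (couniv Y))).
  by exists (fun Y => sval (epsD Y)) => Y; apply: svalP (epsD Y).
pose phiD X Y f := constructive_indefinite_description _ (epsP Y X f).
pose phi X Y f : hom X (R Y) := sval (phiD X Y f).
have phiK X Y f : eps Y ∘ fmap F (phi X Y f) = f.
  by case: (svalP (phiD X Y f)).
have phi_uniq X Y f h : eps Y ∘ fmap F h = f -> phi X Y f = h.
  by case: (svalP (phiD X Y f)) => _; apply.
pose Gmap Y Y' (v : hom Y Y') := phi (R Y) Y' (v ∘ eps Y).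
have Gmap_id Y : Gmap Y Y (idm Y) = idm (R Y).
  by apply: phi_uniq; rewrite fmap_id comp_idr comp_idl.
have Gmap_comp Y Y' Y'' (w : hom Y' Y'') (v : hom Y Y') :
    Gmap Y Y'' (w ∘ v) = Gmap Y' Y'' w ∘ Gmap Y Y' v.
  apply: phi_uniq.
  by rewrite fmap_comp comp_assoc phiK -comp_assoc phiK comp_assoc.
exists (@Functor D C R Gmap Gmap_id Gmap_comp), phi; split.
- move=> X Y; exists (fun h => eps Y ∘ fmap F h) => [f|h].
    exact: phiK.
  exact: phi_uniq.
- move=> X X' Y f u; apply: phi_uniq.
  by rewrite fmap_comp comp_assoc phiK.
- move=> X Y Y' v f; apply: phi_uniq.
  by rewrite fmap_comp comp_assoc phiK -comp_assoc phiK.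
Qed.

Lemma is_product_ext (C : category) (I : Type) (X : I -> C) (P : C)
    (p : forall i : I, hom P (X i)) (Z : C) (g h : hom Z P) :
  is_product p -> (forall i, p i ∘ g = p i ∘ h) -> g = h.
Proof.
move=> pP gh; case: (pP Z (fun i => p i ∘ h)) => k [_ k_uniq].
by rewrite -(k_uniq g) // (k_uniq h).
Qed.

(** Equivariance forces the [n]-th component of a map into the power to be the
    zeroth one precomposed with the [n]-th iterate of the endomorphism of the
    source; hence uniqueness.  The family of these composites commutes with the
    shift; hence existence. *)
Lemma shift_couniversal (C : category) (Y P : C) (p : nat -> hom P Y)
    (s : hom P P) :
    is_product p -> (forall n, p n ∘ s = p n.+1) ->
  couniversal (forget C) Y (SigmaOb s : sigma_cat C) (p 0).
Proof.
move=> pP ps [X t] f /=.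
have [h [ph _]] := pP X (fun n => iter n (fun g => g ∘ t) f).
have h_equiv : h ∘ t = s ∘ h.
  apply: (is_product_ext _ _ _ _ _ _ _ _ pP) => n.
  by rewrite !comp_assoc ps !ph.
exists (exist _ h h_equiv); split=> [|[k k_equiv] /= p0k]; first exact: ph 0.
apply: sigma_hom_inj => /=; apply: (is_product_ext _ _ _ _ _ _ _ _ pP) => n.
rewrite ph; elim: n => [|n IHn] //=.
by rewrite IHn -ps -!comp_assoc -k_equiv.
Qed.

Theorem proposition2p17 (C : category) (hC : has_countable_products C) :
  exists G : functor C (sigma_cat C), forget C ⊣ G.
Proof.
apply: right_adjoint_of_couniversal => Y.
have [P [p pP]] := hC nat (fun=> Y).
have [s [ps _]] := pP P (fun n => p n.+1).
by exists (SigmaOb s : sigma_cat C), (p 0); apply: shift_couniversal.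
Qed.
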